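(* Let $\phi:[0,1]\to[0,1]$ be a Borel function with $\phi(x_0)=1$ for some $x_0\in[0,1]$. (i) If $C_\phi:M^2_\Lambda\to L^2$ is bounded, then $D_-^s(x_0)>0$ and $D_+^i(x_0)<0$. (ii) If $C_\phi:M^2_\Lambda\to L^2$ is compact, then $D_-^s(x_0)=+\infty$ and $D_+^i(x_0)=-\infty$.
   Context: $L^2=L^2([0,1])$ with respect to Lebesgue measure. $\Lambda$ is any strictly increasing infinite sequence of nonnegative real numbers with $\sum_{\lambda\in\Lambda}1/\lambda<\infty$ (a term $\lambda=0$, if present, is omitted). $M^2_\Lambda$ is the closed linear span of $\{x^\lambda:\lambda\in\Lambda\}$ in $L^2$. The composition operator is defined by $C_\phi(g)=g\circ\phi$ for all $g$ in the linear span of $\{x^\lambda:\lambda\in\Lambda\}$; it is called bounded if $\|g\circ\phi\|_{L^2}\le C\|g\|_{L^2}$ for all such $g$, in which case it extends to a bounded operator $M^2_\Lambda\to L^2$; compactness refers to this extension. The one-sided derivatives are $D_-^s(y)=\limsup_{t\to y-}\frac{\phi(y)-\phi(t)}{y-t}$ and $D_+^i(y)=\liminf_{t\to y+}\frac{\phi(y)-\phi(t)}{y-t}$. At $x_0=0$ only the assertion about $D_+^i$ is made, and at $x_0=1$ only the assertion about $D_-^s$. *)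

(* Defs.v *)
From HB Require Import structures.
From mathcomp Require Import all_boot all_order all_algebra.
From mathcomp Require Import all_classical all_reals all_analysis.
Import Order.TTheory GRing.Theory Num.Theory.
Import numFieldNormedType.Exports.

Set Implicit Arguments.
Unset Strict Implicit.
Unset Printing Implicit Defensive.

Local Open Scope classical_set_scope.
Local Open Scope ring_scope.

(** L^2([0,1]) is represented by total functions R -> R whose extension by 0
    of the restriction to [0,1] is in L^2(R); the values off [0,1] are
    irrelevant, and equality in L^2 is almost everywhere equality on [0,1].
    Scalars are real. *)
Section L2_unit_interval.
Context {R : realType}.
Implicit Types f g : R -> R.

Definition inL2 f : Prop :=
  (f \_ `[0, 1] : measurableTypeR R -> R) \in Lfun lebesgue_measure 2%:E.

Definition L2norm f : \bar R :=
  'N[ lebesgue_measure ]_2%:E [ EFin \o (f \_ `[0%R, 1%R])%R ]%E.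

Definition L2eq f g : Prop := f = g %[ae lebesgue_measure in `[0, 1]%classic].

Definition L2cvg (f_ : nat -> R -> R) f : Prop :=
  L2norm (f_ n \- f) @[n --> \oo] --> 0%E.

End L2_unit_interval.

Arguments L2norm {R} f%_ring_scope.

Section Muntz.
Context {R : realType}.
Variable lam : nat -> R.

(** As [0 `^ 0 = 1], an exponent 0 gives the constant function 1 on [0,1]. *)
Definition muntz_span : set (R -> R) :=
  [set g | exists n (c : nat -> R),
             g = (fun x => \sum_(i < n) c i * x `^ lam i)].

Definition muntz_space : set (R -> R) :=
  [set f | inL2 f /\
    forall e : R, 0 < e ->
      exists2 g, muntz_span g & (L2norm (f \- g) < e%:E)%E].

(** Well-definedness of [T] on a.e.-classes follows from linearity up to
    a.e. equality together with the norm bound. *)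
Definition bounded_operator (T : (R -> R) -> R -> R) : Prop :=
  [/\ forall f, muntz_space f -> inL2 (T f),
      forall (a : R) f g, muntz_space f -> muntz_space g ->
        L2eq (T (a \*: f \+ g)) (a \*: T f \+ T g)
    & exists C : R, forall f, muntz_space f ->
        (L2norm (T f) <= C%:E * L2norm f)%E].

Definition compact_operator (T : (R -> R) -> R -> R) : Prop :=
  bounded_operator T /\
  forall f_ : nat -> R -> R,
    (forall n, muntz_space (f_ n)) ->
    (exists B : R, forall n, (L2norm (f_ n) <= B%:E)%E) ->
    exists (u : nat -> nat) (h : R -> R),
      [/\ increasing_seq u, inL2 h & L2cvg (fun n => T (f_ (u n))) h].

Definition comp_bounded (phi : R -> R) : Prop :=
  exists C : R, forall g, muntz_span g ->
    (L2norm (g \o phi) <= C%:E * L2norm g)%E.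

Definition comp_extension (phi : R -> R) (T : (R -> R) -> R -> R) : Prop :=
  bounded_operator T /\ forall g, muntz_span g -> L2eq (T g) (g \o phi).

(** The bounded extension is unique up to a.e. equality, since the span is
    dense in the Muntz space; hence the existential quantifier. *)
Definition comp_compact (phi : R -> R) : Prop :=
  comp_bounded phi /\
  exists T, comp_extension phi T /\ compact_operator T.

End Muntz.

Section one_sided_derivatives.
Context {R : realType}.
Variable phi : R -> R.

Definition left_upper_deriv (y : R) : \bar R :=
  limf_esup (fun t => ((phi y - phi t) / (y - t))%:E) (y^'-).

Definition right_lower_deriv (y : R) : \bar R :=
  limf_einf (fun t => ((phi y - phi t) / (y - t))%:E) (y^'+).

End one_sided_derivatives.

(* Main.v *)
Require Import Defs.
From HB Require Import structures.
From mathcomp Require Import all_boot all_order all_algebra.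
From mathcomp Require Import all_classical all_reals all_analysis.
From mathcomp Require Import measurable_realfun ring lra.
Import Order.TTheory GRing.Theory Num.Theory.
Import numFieldNormedType.Exports.

(** The operator is tested on the powers [x `^ l] with [l] an exponent tending
    to infinity, whose squared norms are at most [(2 * l)^-1]
    ([sqnorm_powR_le]). Since [phi <= 1 = phi x0], the difference quotients of
    [phi] at [x0] are nonnegative on the left and nonpositive on the right. If
    they do not become large in absolute value, say if they are eventually below
    [K], then [1 - phi t <= K * `|x0 - t|] on one side of [x0]. On an interval of
    length comparable to [(l * K)^-1] next to [x0] the power [phi `^ l] is then
    bounded below, so its squared norm is at least [expR (-1) / (4 * l * K)]
    ([linear_contact_sqnorm_ge]). The two norms are of the same order in [l], and
    only the factor [K^-1] separates them.

    For a bounded operator the ratio, and therefore [K^-1], is bounded: slopes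
    cannot be arbitrarily small, so the one-sided derivatives are not zero
    ([bounded_no_flat_contact]).

    For a compact operator no slope [K] at all is possible
    ([compact_no_contact]). Boundedness forces [phi < 1] almost everywhere
    ([phi_lt1_ae]), so the images [Num.sqrt l * phi `^ l] of the normalised
    powers tend to 0 almost everywhere. A subsequence of them converges in [L2],
    necessarily to 0 by Fatou ([L2cvg_pointwise0]), which contradicts the lower
    bound [expR (-1) / (4 * K)] for their squared norms. *)

Local Open Scope classical_set_scope.
Local Open Scope ring_scope.

(** * Squared norms on the unit interval *)

Section SquareNorm.
Context {R : realType}.
Implicit Types f g h : R -> R.
Local Notation mu := (@lebesgue_measure R).

Definition sqnorm f : \bar R := (\int[mu]_(x in `[0%R, 1%R]) ((f x) ^+ 2)%:E)%E.

Lemma sqnorm_ge0 f : (0 <= sqnorm f)%E.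
Proof. by apply: integral_ge0 => x _; rewrite lee_fin sqr_ge0. Qed.

Lemma L2normE f : L2norm f = (sqnorm f `^ 2^-1)%E.
Proof.
rewrite /L2norm unlock /=; congr (_ `^ _)%E.
rewrite /sqnorm [RHS]integral_mkcond; apply: eq_integral => x _ /=.
rewrite !patchE; case: ifPn => _; last by rewrite normr0 powR0// pnatr_eq0.
by rewrite powR_mulrn// -normrX ger0_norm// sqr_ge0.
Qed.

Lemma L2norm_sqrt f : L2norm f = sqrte (sqnorm f).
Proof. by rewrite L2normE poweR12_sqrt// sqnorm_ge0. Qed.

Lemma L2norm_lt f (e : R) : 0 < e -> (L2norm f < e%:E)%E <-> (sqnorm f < (e ^+ 2)%:E)%E.
Proof.
move=> e0; rewrite L2norm_sqrt.
have := sqnorm_ge0 f; case: (sqnorm f) => [r||]//= r0.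
rewrite !lte_fin; rewrite -{2}(sqr_sqrtr (r0 : 0 <= r)).
by rewrite ltr_pXn2r// nnegrE ?sqrtr_ge0// ltW.
Qed.

(** The constant [C] is of arbitrary sign, as in [comp_bounded]; a negative
    [C] forces both norms to vanish. *)
Lemma L2norm_le_sqnorm f g (C : R) :
  (L2norm f <= C%:E * L2norm g)%E -> (sqnorm f <= (C ^+ 2)%:E * sqnorm g)%E.
Proof.
rewrite !L2norm_sqrt.
have := sqnorm_ge0 f; have := sqnorm_ge0 g.
case: (sqnorm g) => [r||]//= r0; case: (sqnorm f) => [s||]//= s0.
- rewrite -EFinM !lee_fin => h.
  rewrite -(sqr_sqrtr (r0 : 0 <= r)) -(sqr_sqrtr (s0 : 0 <= s)) -exprMn.
  by rewrite ler_pXn2r// nnegrE ?sqrtr_ge0// (le_trans _ h)// sqrtr_ge0.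
- have [->|C0] := eqVneq C 0.
    rewrite mul0e expr0n/= mul0e !lee_fin => s1.
    have /eqP : Num.sqrt s = 0 by apply/le_anti; rewrite s1 sqrtr_ge0.
    by rewrite sqrtr_eq0.
  by move=> _; rewrite gt0_muley ?leey// lte_fin exprn_even_gt0.
- have [->|C0] := eqVneq C 0; first by rewrite !mul0e.
  by move=> _; rewrite gt0_muley ?leey// lte_fin exprn_even_gt0.
Qed.

Lemma measurable_unit_itv : measurable (`[0 : R, 1] : set R).
Proof. exact: measurable_itv. Qed.

Lemma measurable_sqr_EFin (D : set R) f :
  measurable D -> measurable_fun D f -> measurable_fun D (EFin \o (fun x => f x ^+ 2)).
Proof. by move=> mD mf; apply/measurable_EFinP; exact: measurable_funX. Qed.

Lemma eq_sqnorm_ae f g : measurable_fun `[0 : R, 1] f -> measurable_fun `[0 : R, 1] g ->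
  L2eq f g -> sqnorm f = sqnorm g.
Proof.
move=> mf mg fg; apply: ge0_ae_eq_integral => //.
- exact: measurable_sqr_EFin.
- exact: measurable_sqr_EFin.
- by move=> x _; rewrite lee_fin sqr_ge0.
- by move=> x _; rewrite lee_fin sqr_ge0.
- move: fg => [N [mN N0 sN]]; exists N; split => // x /= h; apply: sN => /= fgx.
  by apply: h => Dx; rewrite fgx.
Qed.

Lemma inL2P f : inL2 f <-> measurable_fun `[0 : R, 1] f /\ (sqnorm f < +oo)%E.
Proof.
have fin : finite_norm mu 2%:E (f \_ `[0%R, 1%R])%R <-> (sqnorm f < +oo)%E.
  rewrite /finite_norm.
  rewrite -[X in (X < _)%E]/(L2norm f) L2norm_sqrt.
  by case: (sqnorm f) (sqnorm_ge0 f) => [r||]//= _; split => // _; rewrite ltry.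
split.
- move=> /andP[]; rewrite !inE => mf ff; split; last exact/fin.
  by apply/(measurable_restrictT f measurable_unit_itv); exact: mf.
- move=> [mf ff]; apply/andP; split; rewrite !inE; last exact/fin.
  by apply/(measurable_restrictT f measurable_unit_itv).
Qed.

Lemma integral_exprn (n : nat) :
  (\int[mu]_(x in `[0%R, 1%R]) (x ^+ n)%:E = (n.+1%:R^-1)%:E)%E.
Proof.
rewrite (@continuous_FTC2 _ (fun x => x ^+ n)
  (n.+1%:R^-1 \*: (@GRing.exp R)^~ n.+1) 0 1)//=.
- by rewrite expr1n expr0n/= scaler0 oppr0 adde0 /GRing.scale/= mulr1.
- by apply: continuous_subspaceT => x; exact: exprn_continuous.
- split.
  + by move=> x _; apply: derivableZ; exact: exprn_derivable.
  + by apply: cvg_at_right_filter; apply: cvgZr; exact: exprn_continuous.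
  + by apply: cvg_at_left_filter; apply: cvgZr; exact: exprn_continuous.
- move=> x _ /=.
  rewrite derive1E deriveZ; last exact: exprn_derivable.
  rewrite -derive1E exp_derive1 /= scalerA mulVf ?scale1r//.
Qed.

Lemma measurable_powR_comp (D : set R) f (l : R) :
  measurable_fun D f -> measurable_fun D (fun x => f x `^ l).
Proof. by move=> mf; exact: (measurableT_comp (@measurable_powR R l) mf). Qed.

(** Rounding the exponent [2 * l] down to an integer loses only a bounded
    factor against the exact value [(2 * l + 1)^-1] and reduces the integral to
    that of a monomial, whose antiderivative is smooth at 0. *)
Lemma sqnorm_powR_le (l : R) : 0 < l -> (sqnorm (fun x => x `^ l)%R <= ((2 * l)^-1)%:E)%E.
Proof.
move=> l0; set n := Num.truncn (2 * l).
have /andP[n1 n2] : n%:R <= 2 * l < n.+1%:R by apply: truncn_itv; lra.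
apply: (@le_trans _ _ ((n.+1%:R)^-1)%:E); last first.
  by rewrite lee_fin lef_pV2 ?posrE ?mulr_gt0//; exact: ltW.
rewrite -integral_exprn; apply: ge0_le_integral => //=.
- by move=> x _; rewrite lee_fin sqr_ge0.
- by apply: measurable_sqr_EFin => //; exact: measurable_powR_comp.
- by apply/measurable_EFinP; exact: measurable_funX.
- move=> x; rewrite in_itv/= => /andP[x0 x1]; rewrite lee_fin.
  have [->|xn0] := eqVneq x 0.
    by rewrite powR0 ?gt_eqF// expr0n/= exprn_ge0.
  have xp : 0 < x by rewrite lt_neqAle eq_sym xn0.
  rewrite -powR_mulrn ?powR_ge0// -powRrM -powR_mulrn//.
  by rewrite ger_powR ?xp// mulrC.
Qed.

Lemma sqnormZ (c : R) f : measurable_fun `[0 : R, 1] f ->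
  sqnorm (fun x => c * f x)%R = ((c ^+ 2)%:E * sqnorm f)%E.
Proof.
move=> mf; rewrite /sqnorm -ge0_integralZl//.
- by apply: eq_integral => x _; rewrite exprMn EFinM.
- exact: measurable_sqr_EFin.
- by move=> x _; rewrite lee_fin sqr_ge0.
- by rewrite lee_fin sqr_ge0.
Qed.

Lemma sqr_L2norm f : (L2norm f * L2norm f)%E = sqnorm f.
Proof.
rewrite L2norm_sqrt; case: (sqnorm f) (sqnorm_ge0 f) => [r||]//= r0.
by rewrite -EFinM -expr2 sqr_sqrtr.
Qed.

Lemma L2cvg_sqnorm (f_ : nat -> R -> R) h :
  L2cvg f_ h -> sqnorm (f_ n \- h)%R @[n --> \oo] --> 0%E.
Proof.
move=> fh; under eq_fun do rewrite -sqr_L2norm.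
have /cvgeM/(_ fh fh) : ((0 : \bar R) *? 0)%E by rewrite mule_def_fin.
by rewrite mule0.
Qed.

(** A sequence that converges to 0 pointwise and to [h] in quadratic mean has
    [h = 0] almost everywhere: by Fatou, the integral of [h ^+ 2], the pointwise
    limit of [(g_ n - h) ^+ 2], is at most the limit 0 of the integrals. The
    inequality [g ^+ 2 <= 2 * (g - h) ^+ 2 + 2 * h ^+ 2] then gives the claim. *)
Lemma L2cvg_pointwise0 (E : set R) (g_ : nat -> R -> R) h :
  measurable E -> (forall n, measurable_fun E (g_ n)) -> measurable_fun E h ->
  (forall x, E x -> g_ n x @[n --> \oo] --> 0) ->
  (\int[mu]_(x in E) ((g_ n x - h x) ^+ 2)%:E)%E @[n --> \oo] --> 0%E ->
  (\int[mu]_(x in E) ((g_ n x) ^+ 2)%:E)%E @[n --> \oo] --> 0%E.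
Proof.
move=> mE mg mh g0 gh.
have mgh n : measurable_fun E (fun x => g_ n x - h x) by exact: measurable_funB.
have h0 : (\int[mu]_(x in E) ((h x) ^+ 2)%:E = 0)%E.
  apply/le_anti; rewrite integral_ge0 ?andbT; last first.
    by move=> x _; rewrite lee_fin sqr_ge0.
  rewrite -[leRHS](cvg_limn_einf_sup gh).1.
  apply: le_trans (fatou _ _ _ _); last 3 first.
  - exact: mE.
  - by move=> n; exact: measurable_sqr_EFin.
  - by move=> n x _; rewrite lee_fin sqr_ge0.
  rewrite le_eqVlt; apply/orP; left; apply/eqP.
  apply: eq_integral => x /set_mem Ex; apply/esym.
  have cx : ((g_ n x - h x) ^+ 2)%:E @[n --> \oo] --> ((h x) ^+ 2)%:E.
    have c1 : g_ n x - h x @[n --> \oo] --> 0 - h x.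
      by apply: cvgB (g0 _ Ex) _; exact: cvg_cst.
    have := cvgM c1 c1; rewrite sub0r mulrNN -expr2 => c2.
    by apply/fine_cvgP; split; [exact: nearW|exact: c2].
  exact: (cvg_limn_einf_sup cx).1.
apply: (squeeze_cvge (f := cst 0%E) (h := fun n =>
  (2%:E * \int[mu]_(x in E) ((g_ n x - h x) ^+ 2)%:E)%E)).
- apply: nearW => n; apply/andP; split.
    by apply: integral_ge0 => x _; rewrite lee_fin sqr_ge0.
  have -> : (2%:E * \int[mu]_(x in E) ((g_ n x - h x) ^+ 2)%:E =
      \int[mu]_(x in E) (2%:E * ((g_ n x - h x) ^+ 2)%:E + 2%:E * ((h x) ^+ 2)%:E))%E.
    rewrite ge0_integralD//.
    + rewrite !ge0_integralZl//.
      * by rewrite h0 mule0 adde0.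
      * exact: measurable_sqr_EFin.
      * by move=> x _; rewrite lee_fin sqr_ge0.
      * exact: measurable_sqr_EFin.
      * by move=> x _; rewrite lee_fin sqr_ge0.
    + by move=> x _; rewrite -EFinM lee_fin mulr_ge0// sqr_ge0.
    + by apply: measurable_funeM; exact: measurable_sqr_EFin.
    + by move=> x _; rewrite -EFinM lee_fin mulr_ge0// sqr_ge0.
    + by apply: measurable_funeM; exact: measurable_sqr_EFin.
  apply: ge0_le_integral => //.
  + by move=> x _; rewrite lee_fin sqr_ge0.
  + exact: measurable_sqr_EFin.
  + by apply: emeasurable_funD; apply: measurable_funeM; exact: measurable_sqr_EFin.
  + move=> x _; rewrite -!EFinM -EFinD lee_fin.
    by have := sqr_ge0 (g_ n x - 2 * h x); nra.
- exact: cvg_cst.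
- by have := cvgeZl (y := 2%:E) isT gh; rewrite mule0.
Qed.

End SquareNorm.

(** * Linear contact of a function with the level 1 *)

Section Contact.
Context {R : realType}.
Implicit Types phi : R -> R.
Local Notation mu := (@lebesgue_measure R).

(** Both one-sided derivatives are compared with slopes at a point where [phi]
    equals 1; all that is used of such a comparison is that, for every small
    [s], some interval of length [s] in [0,1], on whichever side of the point,
    carries values at least [1 - K * s]. This makes the left and right cases
    the same. *)
Definition linear_contact (K : R) phi : Prop :=
  exists2 d : R, 0 < d & forall s, 0 < s < d ->
    exists a, [/\ 0 <= a, a + s <= 1 &
                  forall t, a < t < a + s -> 1 - K * s <= phi t].

Lemma linear_contact_left (K : R) phi x0 : 0 < x0 <= 1 -> phi x0 = 1 -> 0 < K ->
  (left_upper_deriv phi x0 < K%:E)%E -> linear_contact K phi.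
Proof.
move=> /andP[x00 x01] phi1 K0 /ereal_inf_lt[_ [V Vx0 <-] supV].
have [e /= e0 eV] : nbhs x0 (fun t => t < x0 -> V t) by [].
exists (Num.min e x0); first by rewrite lt_min e0.
move=> s /andP[s0]; rewrite lt_min => /andP[se sx].
exists (x0 - s); split; [lra|lra|].
move=> t /andP[ts tx]; rewrite subrK in tx.
have Vt : V t.
  by apply: eV => //=; rewrite /ball/= ger0_norm; lra.
have : (((phi x0 - phi t) / (x0 - t))%:E < K%:E)%E.
  by apply: le_lt_trans supV; apply: ereal_sup_ubound; exists t.
rewrite phi1 lte_fin ltr_pdivrMr ?subr_gt0// => h.
have : K * (x0 - t) <= K * s by rewrite ler_pM2l//; lra.
lra.
Qed.

Lemma linear_contact_right (K : R) phi x0 : 0 <= x0 < 1 -> phi x0 = 1 -> 0 < K ->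
  (- K%:E < right_lower_deriv phi x0)%E -> linear_contact K phi.
Proof.
move=> /andP[x00 x01] phi1 K0.
rewrite /right_lower_deriv /limf_einf lteN2.
move=> /ereal_inf_lt[_ [V Vx0 <-] supV].
have [e /= e0 eV] : nbhs x0 (fun t => x0 < t -> V t) by [].
exists (Num.min e (1 - x0)); first by rewrite lt_min e0 subr_gt0.
move=> s /andP[s0]; rewrite lt_min => /andP[se sx].
exists x0; split; [lra|lra|].
move=> t /andP[xt ts].
have Vt : V t.
  by apply: eV => //=; rewrite /ball/= distrC ger0_norm; lra.
have : (- ((phi x0 - phi t) / (x0 - t))%:E < K%:E)%E.
  by apply: le_lt_trans supV; apply: ereal_sup_ubound; exists t.
rewrite phi1 -EFinN lte_fin -mulrN -invrN opprB ltr_pdivrMr ?subr_gt0// => h.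
have : K * (t - x0) <= K * s by rewrite ler_pM2l//; lra.
lra.
Qed.

Lemma expR_le_1B (u : R) : 0 <= u <= 2^-1 -> expR (- (2 * u)) <= 1 - u.
Proof.
move=> /andP[u0 u2].
rewrite expRN -[leRHS]invrK lef_pV2 ?posrE ?expR_gt0 ?invr_gt0//; last lra.
apply: le_trans (expR_ge1Dx (2 * u)).
rewrite -[leLHS]mul1r ler_pdivrMr; last lra.
nra.
Qed.

(** On an interval of length [s = (4 * l * K)^-1] the function [phi] is at least
    [1 - (4 * l)^-1], so [(phi x) `^ (2 * l)] is at least [expR (-1)] there.
    Both this length and the squared norm of [x `^ l] are of order [l^-1]. *)
Lemma linear_contact_sqnorm_ge (K : R) phi : 0 < K ->
  measurable_fun `[0 : R, 1] phi -> linear_contact K phi ->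
  exists M : R, forall l, M < l ->
    ((expR (-1) / (4 * l * K))%:E <= sqnorm (fun x => phi x `^ l)%R)%E.
Proof.
move=> K0 mphi [d d0 dK].
(* beyond this bound [s < d], and [K * s <= 2^-1] as [expR_le_1B] requires *)
exists (Num.max 1 (4 * K * d)^-1) => l; rewrite gt_max => /andP[l1 lKd].
have l0 : 0 < l by lra.
pose s := (4 * l * K)^-1.
have s0 : 0 < s by rewrite invr_gt0 !mulr_gt0.
have sd : s < d.
  move: lKd; rewrite /s -[X in X < _ -> _]mul1r -[X in _ -> X < _]mul1r.
  by rewrite !ltr_pdivrMr ?mulr_gt0//; lra.
have [|a [a0 as1 aphi]] := dK s; first by rewrite s0.
pose J : set R := `]a, a + s[%classic.
have JI : J `<=` `[0 : R, 1].
  move=> t; rewrite /J/= !in_itv/= => /andP[at0 ts].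
  by rewrite (le_trans a0 (ltW at0)) (le_trans (ltW ts) as1).
have muJ : mu J = s%:E.
  by rewrite /J lebesgue_measure_itv/= lte_fin ltrDl s0 -EFinB addrAC subrr add0r.
have mphil : measurable_fun `[0 : R, 1] (fun x => phi x `^ l).
  by exact: measurable_powR_comp.
apply: (@le_trans _ _ (\int[mu]_(x in J) (((phi x) `^ l) ^+ 2)%:E)%E); last first.
  apply: ge0_subset_integral => //.
  - exact: measurable_itv.
  - exact: measurable_sqr_EFin.
  - by move=> x _; rewrite lee_fin sqr_ge0.
have -> : ((expR (- 1) / (4 * l * K))%:E = \int[mu]_(x in J) cst (expR (-1))%:E x)%E.
  rewrite integral_cst; last exact: measurable_itv.
  by rewrite EFinM; congr (_ * _)%E; exact: esym.
apply: ge0_le_integral => //=.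
- exact: measurable_itv.
- by apply: measurable_sqr_EFin; [exact: measurable_itv|exact: measurable_funS mphil].
- move=> t; rewrite /J/= in_itv/= => ta; rewrite lee_fin.
  have Ks : K * s = (4 * l)^-1 by rewrite /s invfM mulrCA mulfV ?mulr1// gt_eqF.
  have u2 : 0 <= K * s <= 2^-1.
    by rewrite Ks invr_ge0 lef_pV2 ?posrE; lra.
  have h : expR (- 2^-1) <= phi t `^ l.
    have -> : - 2^-1 = (- (2 * (K * s))) * l :> R.
      by rewrite Ks invfM; field; rewrite gt_eqF.
    rewrite expRM ge0_ler_powR ?nnegrE ?expR_ge0//; first exact: ltW.
      by apply: le_trans (aphi _ ta); lra.
    exact: le_trans (expR_le_1B _ u2) (aphi _ ta).
  have -> : -1 = 2%:R * (- 2^-1) :> R by lra.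
  by rewrite expRM_natl ler_pXn2r ?nnegrE ?expR_ge0 ?powR_ge0.
Qed.

End Contact.

(** * Growth of the exponents *)

Section Exponents.
Context {R : realType}.
Variable lam : nat -> R.
Hypothesis lam_incr : {homo lam : m n / (m < n)%N >-> m < n}.
Hypothesis lam_ge0 : forall n, 0 <= lam n.
Hypothesis lam_sum :
  (\sum_(0 <= n <oo | lam n != 0%R) ((lam n)^-1)%:E < +oo)%E.

Lemma exponents_gt0 n : (0 < n)%N -> 0 < lam n.
Proof. by move=> n0; exact: le_lt_trans (lam_ge0 0) (lam_incr _ _ n0). Qed.

(** Exponents bounded by [M] would make each term of the series but the first
    at least [M^-1]. *)
Lemma exponents_unbounded (M : R) : exists n, M < lam n.
Proof.
apply: contrapT => /forallNP h.
have lamM n : lam n <= M by rewrite leNgt; apply/negP.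
have M0 : 0 < M by exact: lt_le_trans (exponents_gt0 1 isT) (lamM 1%N).
have sum_ge k : ((k%:R / M)%:E <= \sum_(0 <= n <oo | lam n != 0%R) ((lam n)^-1)%:E)%E.
  apply: le_trans (nneseries_lim_ge k.+1 _); last first.
    by move=> n _ _; rewrite lee_fin invr_ge0.
  rewrite big_mkcond big_nat_recl//= -[leLHS]add0e leeD//.
    by case: ifPn => // _; rewrite lee_fin invr_ge0.
  rewrite (eq_bigr (fun i => ((lam i.+1)^-1)%:E)); last first.
    by move=> i _; rewrite gt_eqF// exponents_gt0.
  rewrite sumEFin lee_fin.
  apply: (@le_trans _ _ (\sum_(0 <= i < k) M^-1)).
    by rewrite sumr_const_nat subn0 mulr_natl.
  by apply: ler_sum => i _; rewrite lef_pV2 ?posrE// exponents_gt0.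
move: lam_sum sum_ge.
case: (X in (X < +oo)%E -> _) => [S _|//|_] sum_ge; last first.
  by have := sum_ge 0%N; rewrite leeNy_eq.
have := sum_ge (Num.truncn (S * M)).+1; rewrite lee_fin ler_pdivrMr// leNgt.
move=> /negP; apply; exact: truncnS_gt.
Qed.

Lemma exponents_cvg_pinfty : lam n @[n --> \oo] --> +oo.
Proof.
apply/cvgryPgt => M; have [N MN] := exponents_unbounded M.
exists N => // n /=; rewrite leq_eqVlt => /predU1P[<-//|/lam_incr].
exact: lt_trans.
Qed.

End Exponents.

(** * Composition operators on the Muntz space *)

Section Composition.
Context {R : realType}.
Variables (lam : nat -> R) (phi : R -> R).
Hypothesis lam_incr : {homo lam : m n / (m < n)%N >-> m < n}.
Hypothesis lam_ge0 : forall n, 0 <= lam n.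
Hypothesis lam_sum :
  (\sum_(0 <= n <oo | lam n != 0%R) ((lam n)^-1)%:E < +oo)%E.
Hypothesis phi_meas : measurable_fun `[0 : R, 1] phi.
Hypothesis phi_itv : forall x, x \in `[0, 1] -> phi x \in `[0, 1].
Local Notation mu := (@lebesgue_measure R).

Lemma muntz_span_monomial (c : R) n : muntz_span lam (fun x => c * x `^ lam n).
Proof.
exists n.+1, (fun i => if i == n then c else 0); apply/funext => x.
rewrite big_ord_recr/= eqxx big1 ?add0r// => i _.
by rewrite /= (ltn_eqF (ltn_ord i)) mul0r.
Qed.

Lemma sqnorm_comp_powR_le : comp_bounded lam phi ->
  exists2 C : R, 0 <= C & forall n, (0 < n)%N ->
    (sqnorm (fun x => phi x `^ lam n)%R <= (C / (2 * lam n))%:E)%E.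
Proof.
move=> [C bC]; exists (C ^+ 2); first exact: sqr_ge0.
move=> n n0.
have h : muntz_span lam (fun x => x `^ lam n).
  have := muntz_span_monomial 1 n; congr (muntz_span _ _).
  by apply/funext => x; rewrite mul1r.
apply: le_trans (L2norm_le_sqnorm _ _ _ (bC _ h)) _.
rewrite (EFinM (C ^+ 2)); apply: lee_wpmul2l; first by rewrite lee_fin sqr_ge0.
by apply: sqnorm_powR_le; exact: exponents_gt0.
Qed.

Lemma exponents_unbounded_pos (M : R) : exists n, (0 < n)%N /\ M < lam n.
Proof.
have [n Mn] := exponents_unbounded _ lam_incr lam_ge0 lam_sum M.
by exists n.+1; split => //; apply: lt_trans Mn (lam_incr _ _ _).
Qed.

(** A contact with slope [K] costs a factor of order [K^-1] in the squared norm
    of high powers, which boundedness limits; with the bound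
    [C / (2 * lam n)] on these norms the threshold is [expR (-1) / (2 * C)]. *)
Lemma bounded_no_flat_contact : comp_bounded lam phi ->
  exists2 K : R, 0 < K & ~ linear_contact K phi.
Proof.
move=> /sqnorm_comp_powR_le[C C0 hC].
have e0 := expR_gt0 (-1 : R).
exists (expR (-1) / (2 * (C + 1))); first by rewrite divr_gt0// mulr_gt0//; lra.
set K := (X in linear_contact X _) => hK.
have K0 : 0 < K by rewrite divr_gt0// mulr_gt0//; lra.
have [M hM] := linear_contact_sqnorm_ge K phi K0 phi_meas hK.
have [n [n0 Mn]] := exponents_unbounded_pos M.
have l0 := exponents_gt0 _ lam_incr lam_ge0 _ n0.
have := le_trans (hM _ Mn) (hC n n0); rewrite lee_fin.
have -> : expR (-1) / (4 * lam n * K) = (C + 1) / (2 * lam n).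
  by rewrite /K; field; rewrite !gt_eqF//; lra.
by rewrite ler_pM2r ?invr_gt0 ?mulr_gt0//; lra.
Qed.

Definition below_one : set R := [set x | x \in `[0, 1] /\ phi x < 1].

Lemma below_oneE : below_one = `[0 : R, 1] `&` phi @^-1` [set` `]-oo, 1[].
Proof. by apply/seteqP; split => x /=; rewrite !in_itv/=. Qed.

Lemma measurable_below_one : measurable below_one.
Proof. by rewrite below_oneE; apply: phi_meas => //; exact: measurable_itv. Qed.

(** All powers of [phi] equal 1 where [phi] does, so the measure of that set is
    at most the squared norm of each of them, which is arbitrarily small. *)
Lemma phi_lt1_ae : comp_bounded lam phi -> mu (`[0 : R, 1] `\` below_one) = 0%E.
Proof.
move=> /sqnorm_comp_powR_le[C C0 hC].
set Z := _ `\` _.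
have mZ : measurable Z by apply: measurableD => //; exact: measurable_below_one.
have phiZ x : Z x -> phi x = 1.
  move=> [x01 xE]; have := phi_itv x x01; rewrite in_itv/= => /andP[_ p1].
  apply/eqP; rewrite eq_le p1 leNgt; apply/negP => p1'.
  by apply: xE; split.
have Zle n : (0 < n)%N -> (mu Z <= (C / (2 * lam n))%:E)%E.
  move=> n0; apply: le_trans (hC n n0).
  have -> : mu Z = (\int[mu]_(x in Z) ((phi x `^ lam n) ^+ 2)%:E)%E.
    transitivity (\int[mu]_(x in Z) (cst 1%E x))%E.
      by rewrite integral_cst// mul1e.
    by apply: eq_integral => x /set_mem Zx; rewrite phiZ// powR1 expr1n.
  apply: ge0_subset_integral => //.
  - by apply: measurable_sqr_EFin => //; exact: measurable_powR_comp.
  - by move=> x _; rewrite lee_fin sqr_ge0.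
  - exact: subDsetl.
apply/le_anti; rewrite measure_ge0 andbT.
apply/lee_addgt0Pr => e e0; rewrite add0e.
have [n [n0 Mn]] := exponents_unbounded_pos (C / (2 * e)).
have l0 := exponents_gt0 _ lam_incr lam_ge0 _ n0.
apply: le_trans (Zle n n0) _; rewrite lee_fin ler_pdivrMr ?mulr_gt0//.
by move: Mn; rewrite ltr_pdivrMr ?mulr_gt0//; lra.
Qed.

(** Exponential decay, in the form [y `^ l <= (l * (1 - y))^-1], beats the
    normalising factor. *)
Lemma sqrt_powR_cvg0 (l_ : nat -> R) (y : R) :
  (forall n, 0 < l_ n) -> l_ n @[n --> \oo] --> +oo -> 0 <= y < 1 ->
  Num.sqrt (l_ n) * y `^ l_ n @[n --> \oo] --> 0.
Proof.
move=> l0 loo /andP[y0 y1].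
have ub n : Num.sqrt (l_ n) * y `^ l_ n <= (1 - y)^-1 * (Num.sqrt (l_ n))^-1.
  have yle : y <= expR (- (1 - y)) by apply: le_trans (expR_ge1Dx _); lra.
  have h : y `^ l_ n <= (l_ n * (1 - y))^-1.
    apply: (@le_trans _ _ (expR (- (1 - y)) `^ l_ n)).
      by rewrite ge0_ler_powR ?nnegrE ?expR_ge0// ltW.
    rewrite -expRM mulNr expRN lef_pV2 ?posrE ?expR_gt0//; last first.
      by rewrite mulr_gt0// subr_gt0.
    by apply: le_trans (expR_ge1Dx _); rewrite mulrC; lra.
  apply: le_trans (ler_wpM2l (sqrtr_ge0 _) h) _.
  rewrite -{2}(sqr_sqrtr (ltW (l0 n))) le_eqVlt; apply/orP; left; apply/eqP.
  by field; rewrite gt_eqF ?sqrtr_gt0//= gt_eqF// subr_gt0.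
apply: (squeeze_cvgr (f := cst 0) (h := fun n => (1 - y)^-1 * (Num.sqrt (l_ n))^-1)).
- by apply: nearW => n; rewrite ub mulr_ge0// ?sqrtr_ge0// powR_ge0.
- exact: cvg_cst.
- rewrite -[X in _ --> X](mulr0 (1 - y)^-1); apply: cvgMr.
  apply/gtr0_cvgV0; first by apply: nearW => n; rewrite sqrtr_gt0.
  apply/cvgryPgt => M; near=> n.
  apply: le_lt_trans (ler_norm M) _; rewrite -sqrtr_sqr ltr_sqrt// .
  near: n; move/cvgryPgt : loo; exact.
Unshelve. all: by end_near. Qed.

Lemma muntz_span_space g : muntz_span lam g -> inL2 g -> muntz_space lam g.
Proof.
move=> sg gL2; split=> // e e0; exists g => //.
apply/L2norm_lt => //.
have -> : sqnorm (g \- g)%R = 0%E.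
  by rewrite /sqnorm integral0_eq// => x _; rewrite /= subrr expr0n.
by rewrite lte_fin exprn_gt0.
Qed.

Lemma normalized_monomial_sqnorm n : (0 < n)%N ->
  (sqnorm (fun x => Num.sqrt (lam n) * x `^ lam n)%R <= (2^-1)%:E)%E.
Proof.
move=> n0; have l0 := exponents_gt0 _ lam_incr lam_ge0 _ n0.
rewrite sqnormZ; last exact: measurable_powR_comp.
rewrite sqr_sqrtr; last exact: ltW.
have -> : 2^-1 = lam n * (2 * lam n)^-1 :> R by field; rewrite gt_eqF.
rewrite EFinM; apply: lee_wpmul2l; first by rewrite lee_fin ltW.
exact: sqnorm_powR_le.
Qed.

Lemma normalized_monomial_inL2 n : (0 < n)%N ->
  inL2 (fun x => Num.sqrt (lam n) * x `^ lam n).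
Proof.
move=> n0; apply/inL2P; split.
  by apply: measurable_funM => //; exact: measurable_powR_comp.
exact: le_lt_trans (normalized_monomial_sqnorm _ n0) (ltry _).
Qed.

Lemma sqnorm_below_one f : comp_bounded lam phi -> measurable_fun `[0 : R, 1] f ->
  (sqnorm f = \int[mu]_(x in below_one) ((f x) ^+ 2)%:E)%E.
Proof.
move=> bC mf.
have EI : below_one `<=` `[0 : R, 1] by move=> x [].
rewrite -[below_one](setIidr EI) -setDD.
apply: ge0_negligible_integral => //.
- by apply: measurableD => //; exact: measurable_below_one.
- exact: measurable_sqr_EFin.
- by move=> x _; rewrite lee_fin sqr_ge0.
- exact: (phi_lt1_ae bC).
Qed.

(** Compactness applied to normalised powers yields a subsequence whose images
    converge in [L2]. These images tend to 0 almost everywhere, hence in [L2],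
    whereas a contact of any slope [K] keeps their squared norms above
    [expR (-1) / (4 * K)]. *)
Lemma compact_no_contact (K : R) : comp_compact lam phi -> 0 < K ->
  ~ linear_contact K phi.
Proof.
move=> [bC [T [[[TL2 _ _] TE] [_ cT]]]] K0 hK.
(* the shift avoids a possible zero exponent *)
pose l_ n := lam n.+1.
have l0 n : 0 < l_ n by exact: (exponents_gt0 _ lam_incr lam_ge0).
pose f_ n := fun x : R => Num.sqrt (l_ n) * x `^ l_ n.
have fspan n : muntz_span lam (f_ n) by exact: muntz_span_monomial.
have fspace n : muntz_space lam (f_ n).
  by apply: muntz_span_space => //; exact: normalized_monomial_inL2.
have [|u [h [incr_u hL2 Tfh]]] := cT _ fspace.
  exists 1 => n; apply/ltW/L2norm_lt => //.
  apply: le_lt_trans (normalized_monomial_sqnorm _ _) _ => //.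
  by rewrite lte_fin expr1n invf_lt1 ?ltr1n.
pose g_ n := f_ (u n) \o phi.
have u_ge n : (n <= u n)%N.
  elim: n => // n IH; apply: leq_ltn_trans IH _.
  by move/increasing_seqP : incr_u => /(_ n).
have luoo : l_ (u n) @[n --> \oo] --> +oo.
  apply: (@ger_cvgy _ _ _ _ lam); last exact: exponents_cvg_pinfty.
  by apply: nearW => n; apply/ltW/lam_incr; rewrite ltnS u_ge.
have mg n : measurable_fun `[0 : R, 1] (g_ n).
  by apply: measurable_funM => //; exact: measurable_powR_comp.
have mh : measurable_fun `[0 : R, 1] h by case/inL2P : hL2.
have mE := measurable_below_one.
have EI : below_one `<=` `[0 : R, 1] by move=> x [].
have gh : (\int[mu]_(x in below_one) ((g_ n x - h x) ^+ 2)%:E)%E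
    @[n --> \oo] --> 0%E.
  have := L2cvg_sqnorm _ _ Tfh; apply: cvg_trans; apply: near_eq_cvg.
  apply: nearW => n; rewrite -sqnorm_below_one//; last exact: measurable_funB.
  have mT : measurable_fun `[0 : R, 1] (T (f_ (u n))).
    by have /inL2P[] := TL2 _ (fspace (u n)).
  apply: eq_sqnorm_ae; [exact: measurable_funB|exact: measurable_funB|].
  have [N [mN N0 sN]] := TE _ (fspan (u n)).
  exists N; split => // x /= H; apply: sN => /= H'; apply: H => Dx.
  by rewrite (H' Dx).
have g0 : sqnorm (g_ n) @[n --> \oo] --> 0%E.
  under eq_fun do rewrite sqnorm_below_one//.
  apply: (L2cvg_pointwise0 _ _ h mE) => //.
  - by move=> n; exact: measurable_funS (mg n).
  - exact: measurable_funS mh.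
  - move=> x [x01 px1]; apply: (sqrt_powR_cvg0 (fun n => l_ (u n))) => //.
    by move: (phi_itv _ x01); rewrite in_itv/= => /andP[-> _].
have [M hM] := linear_contact_sqnorm_ge K phi K0 phi_meas hK.
have : ((expR (-1) / (4 * K))%:E <= 0 :> \bar R)%E.
  apply: (cvge_to_ge g0); near=> n.
  have Mn : M < l_ (u n) by near: n; move/cvgryPgt : luoo; exact.
  rewrite /g_ /f_ /comp sqnormZ; last exact: measurable_powR_comp.
  rewrite sqr_sqrtr; last exact: ltW.
  have -> : expR (-1) / (4 * K) = l_ (u n) * (expR (-1) / (4 * l_ (u n) * K)).
    by field; rewrite !gt_eqF.
  rewrite EFinM; apply: lee_wpmul2l; first by rewrite lee_fin ltW.
  exact: hM.
rewrite lee_fin leNgt => /negP; apply.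
by rewrite divr_gt0 ?expR_gt0// mulr_gt0.
Unshelve. all: by end_near. Qed.

End Composition.

Theorem theorem4p3 (R : realType) (lam : nat -> R) (phi : R -> R) (x0 : R)
    (lam_incr : {homo lam : m n / (m < n)%N >-> m < n})
    (lam_ge0 : forall n, 0 <= lam n)
    (lam_sum : (\sum_(0 <= n <oo | lam n != 0%R) ((lam n)^-1)%:E < +oo)%E)
    (phi_meas : measurable_fun `[0 : R, 1] phi)
    (phi_itv : forall x, x \in `[0, 1] -> phi x \in `[0, 1])
    (x0_itv : x0 \in `[0, 1])
    (phi_x0 : phi x0 = 1) :
  (comp_bounded lam phi ->
     (0 < x0 -> (0 < left_upper_deriv phi x0)%E) /\
     (x0 < 1 -> (right_lower_deriv phi x0 < 0)%E)) /\
  (comp_compact lam phi ->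
     (0 < x0 -> left_upper_deriv phi x0 = +oo%E) /\
     (x0 < 1 -> right_lower_deriv phi x0 = -oo%E)).
Proof.
move: x0_itv; rewrite in_itv/= => /andP[x00 x01].
split => hC.
- have [K K0 nK] := bounded_no_flat_contact _ _ lam_incr lam_ge0 lam_sum phi_meas hC.
  split=> x0'; rewrite ltNge; apply/negP => D0; apply: nK.
  + apply: (linear_contact_left _ _ _ _ phi_x0) => //; first by rewrite x0'.
    by apply: le_lt_trans D0 _; rewrite lte_fin.
  + apply: (linear_contact_right _ _ _ _ phi_x0) => //; first by rewrite x00.
    by apply: lt_le_trans D0; rewrite -EFinN lte_fin oppr_lt0.
- have nK K := compact_no_contact _ _ lam_incr lam_ge0 lam_sum phi_meas phi_itv K hC.
  split=> x0'.
  + have h K : 0 < K -> (K%:E <= left_upper_deriv phi x0)%E.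
      move=> K0; rewrite leNgt; apply/negP => DK; apply: (nK K K0).
      by apply: (linear_contact_left _ _ _ _ phi_x0) => //; rewrite x0'.
    by apply/eqyP => K K0; exact: h.
  + have h K : 0 < K -> (right_lower_deriv phi x0 <= - K%:E)%E.
      move=> K0; rewrite leNgt; apply/negP => DK; apply: (nK K K0).
      by apply: (linear_contact_right _ _ _ _ phi_x0) => //; rewrite x00.
    have /eqyP Dy K : 0 < K -> (K%:E <= - right_lower_deriv phi x0)%E.
      by move=> K0; rewrite leeNr; exact: h.
    by rewrite -[LHS]oppeK Dy.
Qed.
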